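(* Let $S$ be a finite Kleene relation algebra satisfying the Tarski rule, let $p_0 \in S$ be a forest, let $x, y \in S$ be points with $y = ((p_0^T)^*\cdot x) \sqcap ((p_0 \sqcap 1)\cdot\top)$. Consider the program with program variables $p, t, w$ ranging over $S$, started with $p = p_0$: $w := x$; while $y \neq p^T\cdot w$ do $t := w$; $w := p^T\cdot w$; $p := (t \sqcap y^T)\sqcup(\overline{t}\sqcap p)$ od. Then the program terminates, and in its final state: $p$ is a forest; $y = ((p^T)^*\cdot x) \sqcap ((p \sqcap 1)\cdot\top)$; $p^*\cdot(p^T)^* = p_0^*\cdot(p_0^T)^*$; $p \sqcap 1 = p_0 \sqcap 1$; and $p = (v \sqcap y^T) \sqcup (\overline{v} \sqcap p_0)$ where $v = (p_0^T)^*\cdot x$.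
   Context: A Kleene relation algebra is a structure $(S,\sqcup,\sqcap,\cdot,\overline{\phantom{x}},{}^T,{}^*,\bot,\top,1)$ such that $(S,\sqcup,\sqcap,\overline{\phantom{x}},\bot,\top)$ is a Boolean algebra with order $x \sqsubseteq y \iff x \sqcup y = y$; $(S,\sqcup,\cdot,\bot,1)$ is an idempotent semiring ($\cdot$ associative with two-sided unit $1$, distributing over $\sqcup$, $\bot$ a two-sided zero of $\cdot$); transposition satisfies $(x\sqcup y)^T = x^T \sqcup y^T$, $(x^T)^T = x$, $(x\cdot y)^T = y^T\cdot x^T$ and $(x\cdot y)\sqcap z \sqsubseteq x\cdot(y\sqcap(x^T\cdot z))$; and the star satisfies $1\sqcup y\cdot y^* = y^* = 1 \sqcup y^*\cdot y$, $z\sqcup y\cdot x\sqsubseteq x \Rightarrow y^*\cdot z\sqsubseteq x$, $z \sqcup x\cdot y \sqsubseteq x \Rightarrow z\cdot y^*\sqsubseteq x$. The Tarski rule states $\top\cdot x\cdot\top = \top$ for every $x \neq \bot$. Write $x^+ = x\cdot x^*$. An element $x$ is univalent if $x^T x\sqsubseteq 1$, total if $1\sqsubseteq x x^T$, a mapping if univalent and total, injective if $x x^T\sqsubseteq 1$, surjective if $1\sqsubseteq x^T x$, a vector if $x\cdot\top = x$, a point if it is an injective surjective vector, acyclic if $x^+\sqsubseteq\overline 1$, and a forest if it is a mapping and $x\sqcap\overline{1}$ is acyclic. Programs are sequential while-programs with the usual semantics. The assignment $p := (t\sqcap y^T)\sqcup(\overline t\sqcap p)$ is the array update setting the parent of node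 $t$ to $y$; $p^T\cdot w$ reads the parent of $w$. *)

(* Defs.v *)
From HB Require Import structures.
From mathcomp Require Import all_boot all_order.

Set Implicit Arguments.
Unset Strict Implicit.
Unset Printing Implicit Defensive.

Import Order.TTheory.

(* Same format as in matrix.v, so that both can be imported. *)
Reserved Notation "A ^T" (format "A ^T").

Declare Scope kra_scope.
Delimit Scope kra_scope with kra.
Local Open Scope group_scope.
Local Open Scope order_scope.

(* The Boolean algebra and its order are those of ctbDistrLatticeType: `|`, `&`,
   ~`, \bot, \top and <=, where x <= y iff x `|` y = y (leEjoin). Composition
   x * y and its unit 1 form a monoidType, which provides associativity and the
   unit laws; the semiring addition is the join, whose laws come from the
   lattice. *)
HB.mixin Record isKleeneRelAlg d S
    of Order.CTBDistrLattice d S & monoid.Monoid S := {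
  conv : S -> S;
  star : S -> S;
  mulUl : forall x y z : S, (x `|` y) * z = (x * z) `|` (y * z);
  mulUr : forall x y z : S, x * (y `|` z) = (x * y) `|` (x * z);
  mul0x : forall x : S, (\bot : S) * x = \bot;
  mulx0 : forall x : S, x * (\bot : S) = \bot;
  convU : forall x y : S, conv (x `|` y) = conv x `|` conv y;
  convK : forall x : S, conv (conv x) = x;
  convM : forall x y : S, conv (x * y) = conv y * conv x;
  dedekind : forall x y z : S, (x * y) `&` z <= x * (y `&` (conv x * z));
  star_unfoldl : forall y : S, (1 : S) `|` (y * star y) = star y;
  star_unfoldr : forall y : S, (1 : S) `|` (star y * y) = star y;
  star_inductl : forall x y z : S, z `|` (y * x) <= x -> star y * z <= x;
  star_inductr : forall x y z : S, z `|` (x * y) <= x -> z * star y <= x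
}.

#[short(type="kleeneRelAlgType")]
HB.structure Definition KleeneRelAlg d :=
  { S of isKleeneRelAlg d S & Order.CTBDistrLattice d S & monoid.Monoid S }.

#[short(type="finKleeneRelAlgType")]
HB.structure Definition FinKleeneRelAlg d :=
  { S of KleeneRelAlg d S & Finite S }.

Notation "x ^T" := (conv x) : kra_scope.
Notation "x ^*" := (star x) : kra_scope.
Local Open Scope kra_scope.

Section RelationalNotions.
Context {d : Order.disp_t} {S : kleeneRelAlgType d}.
Implicit Types x : S.

Definition plus_closure x : S := x * x^*.

Definition is_univalent x : bool := x^T * x <= 1.
Definition is_total x : bool := 1 <= x * x^T.
Definition is_mapping x : bool := is_univalent x && is_total x.
Definition is_injective x : bool := x * x^T <= 1.
Definition is_surjective x : bool := 1 <= x^T * x.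
Definition is_vector x : bool := x * \top == x.
Definition is_point x : bool :=
  [&& is_injective x, is_surjective x & is_vector x].
Definition is_acyclic x : bool := plus_closure x <= ~` 1.
Definition is_forest x : bool := is_mapping x && is_acyclic (x `&` ~` 1).

End RelationalNotions.

Definition tarski_rule d (S : kleeneRelAlgType d) : Prop :=
  forall x : S, x != \bot -> \top * x * \top = \top.

Section WhilePrograms.
Variables (var : eqType) (val : Type).

Definition state := var -> val.

Definition update (s : state) (v : var) (a : val) : state :=
  fun u => if u == v then a else s u.

Inductive cmd : Type :=
| Skip
| Assign of var & (state -> val)
| Seq of cmd & cmd
| If of pred state & cmd & cmd
| While of pred state & cmd.

Inductive exec : cmd -> state -> state -> Prop :=
| exec_skip s :
    exec Skip s s
| exec_assign v (e : state -> val) s :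
    exec (Assign v e) s (update s v (e s))
| exec_seq c1 c2 s1 s2 s3 :
    exec c1 s1 s2 -> exec c2 s2 s3 -> exec (Seq c1 c2) s1 s3
| exec_if_true (b : pred state) c1 c2 s1 s2 :
    b s1 -> exec c1 s1 s2 -> exec (If b c1 c2) s1 s2
| exec_if_false (b : pred state) c1 c2 s1 s2 :
    ~~ b s1 -> exec c2 s1 s2 -> exec (If b c1 c2) s1 s2
| exec_while_true (b : pred state) c s1 s2 s3 :
    b s1 -> exec c s1 s2 -> exec (While b c) s2 s3 -> exec (While b c) s1 s3
| exec_while_false (b : pred state) c s :
    ~~ b s -> exec (While b c) s s.

(* Commands are deterministic and cannot fail, so that the existence of a final
   state expresses termination. *)
Definition terminates (c : cmd) (s : state) : Prop := exists s', exec c s s'.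

End WhilePrograms.

Arguments Skip {var val}.

Inductive pvar : Type := var_p | var_t | var_w.

Definition pvar_eqb (u v : pvar) : bool :=
  match u, v with
  | var_p, var_p | var_t, var_t | var_w, var_w => true
  | _, _ => false
  end.

Lemma pvar_eqP : Equality.axiom pvar_eqb.
Proof. by case; case; constructor. Qed.

HB.instance Definition _ := hasDecEq.Build pvar pvar_eqP.

Definition path_compression d (S : kleeneRelAlgType d) (x y : S) : cmd pvar S :=
  Seq (Assign var_w (fun _ => x))
      (While (fun s => y != (s var_p)^T * s var_w)
         (Seq (Assign var_t (fun s => s var_w))
         (Seq (Assign var_w (fun s => (s var_p)^T * s var_w))
              (Assign var_p (fun s =>
                 (s var_t `&` y^T) `|` (~` (s var_t) `&` s var_p)))))).

(* Main.v *)
Require Import Defs.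
From HB Require Import structures.
From mathcomp Require Import all_boot all_order.

Set Implicit Arguments.
Unset Strict Implicit.
Unset Printing Implicit Defensive.

Import Order.TTheory Order.CTheory.

Local Open Scope group_scope.
Local Open Scope order_scope.
Local Open Scope kra_scope.

(* By the Tarski rule the iterated parents of [x] are points any two of which
   are equal or disjoint; by finiteness they exhaust [v = p0^T^* * x], so one of
   them is [y]. As long as [y] is not reached, the current node has not been
   redirected and its parent is still the one in [p0]. Hence the loop follows
   the original path, and it ends with [p = (v `&` y^T) `|` (~` v `&` p0)]. The
   other postconditions are algebraic consequences of this formula, valid in
   every Kleene relation algebra. *)

Section KleeneRelationAlgebra.
Context {d : Order.disp_t} {S : kleeneRelAlgType d}.
Implicit Types a b e p q u v w x y z : S.

(** * Order, converse and star *)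

Lemma le_meetU u a b : a `&` u <= b -> a `&` ~` u <= b -> a <= b.
Proof. by move=> h h'; rewrite -[a]meetx1 -(joinxC u) meetUr leUx h. Qed.

Lemma le_mul2 a a' b b' : a <= a' -> b <= b' -> a * b <= a' * b'.
Proof.
by move=> /join_idPr <- /join_idPr <-; rewrite mulUl !mulUr -!joinA leUl.
Qed.

Lemma le_mull a b b' : b <= b' -> a * b <= a * b'.
Proof. exact: le_mul2. Qed.

Lemma le_mulr a a' b : a <= a' -> a * b <= a' * b.
Proof. by move=> h; apply: le_mul2. Qed.

Lemma le_conv a b : (a^T <= b^T) = (a <= b).
Proof. by rewrite !leEjoin -convU (can_eq convK). Qed.

Lemma le_convl a b : (a^T <= b) = (a <= b^T).
Proof. by rewrite -[in LHS](convK b) le_conv. Qed.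

Lemma conv_top : \top^T = \top :> S.
Proof. by apply/eqP; rewrite -le1x -le_convl lex1. Qed.

Lemma conv_bot : \bot^T = \bot :> S.
Proof. by apply/eqP; rewrite -lex0 le_convl le0x. Qed.

Lemma conv1 : 1^T = 1 :> S.
Proof.
by rewrite -[1^T]mulg1 -[in RHS](convK 1) -[1^T in RHS]mulg1 convM convK.
Qed.

Lemma convI a b : (a `&` b)^T = a^T `&` b^T.
Proof.
apply/eqP; rewrite eq_le lexI !le_conv leIl leIr /=.
by rewrite -le_convl lexI !le_convl leIl leIr.
Qed.

Lemma dedekindr a b c : (a * b) `&` c <= (a `&` (c * b^T)) * b.
Proof.
by have := dedekind b^T a^T c^T; rewrite -le_conv convK !(convI, convM, convK).
Qed.

(** The Dedekind rule gives [f <= f * f^T * f], and both outer factors lie below [1]. *)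
Lemma le1_conv e : e <= 1 -> e^T = e.
Proof.
suff sub (f : S) : f <= 1 -> f <= f^T.
  by move=> he; apply/eqP; rewrite eq_le sub // andbT le_convl sub.
move=> hf; have := dedekind f 1 f; rewrite mulg1 meetxx => /le_trans; apply.
apply: le_trans (le_mulr _ hf) _; rewrite mul1g; apply: le_trans (leIr _ _) _.
by rewrite -[leRHS]mulg1 le_mull.
Qed.

Lemma star_ge1 a : 1 <= a^*.
Proof. by rewrite -star_unfoldl leUl. Qed.

Lemma mul_star_le a : a * a^* <= a^*.
Proof. by rewrite -[leRHS]star_unfoldl leUr. Qed.

Lemma star_mul_le a : a^* * a <= a^*.
Proof. by rewrite -[leRHS]star_unfoldr leUr. Qed.

Lemma le_star a : a <= a^*.
Proof.
by rewrite -[leLHS]mulg1;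
apply: le_trans (mul_star_le a); apply/le_mull/star_ge1.
Qed.

Lemma star_idem a : a^* * a^* <= a^*.
Proof. by apply: star_inductl; rewrite leUx lexx mul_star_le. Qed.

Lemma star_least a b : 1 <= b -> a * b <= b -> a^* <= b.
Proof.
by move=> b1 ab; rewrite -[a^*]mulg1; apply: star_inductl; rewrite leUx b1.
Qed.

Lemma star_mono a b : a <= b^* -> a^* <= b^*.
Proof.
move=> ab; apply: star_least (star_ge1 b) _.
exact: le_trans (le_mulr _ ab) (star_idem b).
Qed.

Lemma conv_star a : a^*^T = a^T^*.
Proof.
have sub (b : S) : b^T^* <= b^*^T.
  apply: star_least; first by rewrite -conv1 le_conv star_ge1.
  by rewrite -convM le_conv star_mul_le.
by apply/eqP; rewrite eq_le sub andbT le_convl -[X in X^* <= _]convK sub.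
Qed.

Lemma le_plus a : a <= plus_closure a.
Proof. by rewrite -[leLHS]mulg1 le_mull // star_ge1. Qed.

Lemma star_le_plus a : a^* `&` ~` 1 <= plus_closure a.
Proof.
by rewrite -star_unfoldl meetUl meetxC join0x leIl.
Qed.

Lemma plus_mono a b : a <= plus_closure b -> plus_closure a <= plus_closure b.
Proof.
move=> ab; have plus_star : plus_closure b <= b^* by exact: mul_star_le.
apply: le_trans (le_mul2 ab (star_mono (le_trans ab plus_star))) _.
by rewrite /plus_closure -mulgA le_mull // star_idem.
Qed.

(** Acyclicity in [is_forest] disregards loops, while reachability uses the whole element; this
    identity links the two. *)
Lemma star_irreflexive_part a : (a `&` ~` 1)^* = a^*.
Proof.
apply/eqP; rewrite eq_le !star_mono ?(le_trans (leIl _ _) (le_star _)) //.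
apply: (le_meetU (u := 1)); last exact: le_star.
exact: le_trans (leIr _ _) (star_ge1 _).
Qed.

(** Star induction: a [p^T] step cancels the first step of a nonempty [p] path by univalence, and
    before an empty path it already lies in [p^T^*]. *)
Lemma univalent_star p : is_univalent p -> p^T^* * p^* <= p^* `|` p^T^*.
Proof.
move=> p_univ; apply: star_inductl; rewrite leUx leUl mulUr leUx /=.
apply/andP; split; last exact: le_trans (mul_star_le _) (leUr _ _).
rewrite -[X in _ * X]star_unfoldl mulUr mulg1 leUx.
rewrite (le_trans (le_star _) (leUr _ _)) mulgA /=.
by apply: le_trans (le_mulr _ p_univ) _; rewrite mul1g leUl.
Qed.

Lemma univalent_church_rosser p :
  is_univalent p -> p^T^* * p^* <= p^* * p^T^*.
Proof.
move/univalent_star=> /le_trans; apply; rewrite leUx.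
rewrite -[X in X <= _]mulg1 -[X in _ && (X <= _)]mul1g.
by rewrite le_mull ?le_mulr ?star_ge1.
Qed.

(** * Vectors and points *)

Lemma total_top p : is_total p = (p * \top == \top).
Proof.
apply/idP/eqP => [p_total|ptop].
  apply/eqP; rewrite -le1x -[leLHS]mul1g; apply: le_trans (le_mulr _ p_total) _.
  by rewrite -mulgA le_mull // lex1.
have := dedekind p \top 1; rewrite ptop meet1x mulg1 => /le_trans; apply.
by rewrite le_mull // leIr.
Qed.

Lemma mul_top v : is_vector v -> v * \top = v.
Proof. by move/eqP. Qed.

Lemma top_conv v : is_vector v -> \top * v^T = v^T.
Proof. by move=> v_vec; rewrite -conv_top -convM mul_top. Qed.

Lemma vector_mul_le v a : is_vector v -> v * a <= v.
Proof. by move=> v_vec; rewrite -[leRHS]mul_top // le_mull ?lex1. Qed.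

Lemma vectorM a v : is_vector v -> is_vector (a * v).
Proof. by move=> v_vec; rewrite /is_vector -mulgA mul_top. Qed.

Lemma vectorP v : v * \top <= v -> is_vector v.
Proof.
by move=> hv; rewrite /is_vector eq_le hv -[leLHS]mulg1 le_mull ?lex1.
Qed.

Lemma vector_bot : is_vector (\bot : S).
Proof. by rewrite /is_vector mul0x. Qed.

Lemma vectorU u v : is_vector u -> is_vector v -> is_vector (u `|` v).
Proof. by move=> u_vec v_vec; rewrite /is_vector mulUl !mul_top. Qed.

Lemma vectorI u v : is_vector u -> is_vector v -> is_vector (u `&` v).
Proof.
move=> u_vec v_vec; apply: vectorP.
by rewrite lexI -{2}(mul_top u_vec) -{3}(mul_top v_vec) !le_mulr ?leIl ?leIr.
Qed.

Lemma vectorC v : is_vector v -> is_vector (~` v).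
Proof.
move=> v_vec; apply: vectorP; rewrite -disj_leC -lex0.
apply: le_trans (dedekindr _ _ _) _.
by rewrite conv_top (mul_top v_vec) meetCx mul0x.
Qed.

(** Meeting with a vector selects rows, which right multiplication does not mix; the Dedekind rule
    gives the harder inequality. *)
Lemma vector_meetM v a b : is_vector v -> (v `&` a) * b = v `&` (a * b).
Proof.
move=> v_vec; apply/eqP; rewrite eq_le lexI -andbA; apply/and3P; split.
- by apply: le_trans (le_mulr _ (leIl _ _)) _; apply: vector_mul_le.
- by rewrite le_mulr ?leIr.
rewrite meetC; apply: le_trans (dedekindr _ _ _) _; rewrite meetC le_mulr //.
by rewrite leI2 // vector_mul_le.
Qed.

(** On either side [v] restricts the intermediate node of the composition. *)
Lemma vector_conv_meetM v a b :
  is_vector v -> (v `&` a)^T * b = a^T * (v `&` b).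
Proof.
move=> v_vec; apply/eqP; rewrite eq_le; apply/andP; split.
  have := dedekind (v `&` a)^T b \top; rewrite meetx1 => /le_trans; apply.
  rewrite convK vector_meetM //; apply: le_mul2; first by rewrite le_conv leIr.
  by rewrite lexI leIl (le_trans (leIr _ _) (leIl _ _)).
have := dedekindr a^T (v `&` b) \top; rewrite meetx1 => /le_trans; apply.
apply: le_mul2; last exact: leIr.
rewrite [leRHS]convI meetC leI2 // -[leRHS]top_conv // le_mull //.
by rewrite le_conv leIl.
Qed.

Lemma vector_conv_rect v y :
  is_vector v -> is_vector y -> v `&` y^T = v * y^T.
Proof.
by move=> v_vec y_vec; rewrite -{1}(top_conv y_vec) -vector_meetM // meetx1.
Qed.

Lemma vector_meet_coreflexive e z : e <= 1 -> (e * \top) `&` z = e * z.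
Proof.
move=> he; apply/eqP; rewrite eq_le lexI le_mull ?lex1 //.
rewrite -[X in _ && (_ <= X)]mul1g le_mulr // !andbT.
apply: le_trans (dedekind _ _ _) _; rewrite meet1x le1_conv // le_mull //.
by rewrite -[leRHS]mul1g le_mulr.
Qed.

Lemma pointP u : is_point u ->
  [/\ u * u^T <= 1, 1 <= u^T * u & is_vector u].
Proof. by case/and3P. Qed.

Lemma point_top u : is_point u -> u^T * \top = \top.
Proof. by case/pointP=> _ us _; apply/eqP; rewrite -total_top /is_total convK. Qed.

Lemma mapping_point p u : is_mapping p -> is_point u -> is_point (p^T * u).
Proof.
move=> /andP[p_univ p_total] /pointP[u_inj u_surj u_vec].
rewrite /is_point /is_injective /is_surjective vectorM // convM convK andbT.
apply/andP; split.
  rewrite mulgA -(mulgA _ u); apply: le_trans p_univ.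
  by rewrite le_mulr // -[leRHS]mulg1 le_mull.
apply: le_trans u_surj _; rewrite mulgA -(mulgA u^T) le_mulr //.
by rewrite -[leLHS]mulg1 le_mull.
Qed.

(** The chain is [w <= w * u^T * u <= w * w^T * u <= u]. *)
Lemma le_point u w : is_point u -> is_point w -> u <= w -> u = w.
Proof.
move=> /pointP[_ u_surj u_vec] /pointP[w_inj _ w_vec] uw.
apply/eqP; rewrite eq_le uw /= -(mul_top w_vec) -[w]mulg1.
apply: (le_trans (le_mulr _ (le_mull w u_surj))).
rewrite !mulgA -(mulgA (w * u^T)) (mul_top u_vec) -[leRHS]mul1g le_mulr //.
by apply: le_trans w_inj; rewrite le_mull ?le_conv.
Qed.

(* By the Tarski rule a point is an atom among the vectors. *)
Lemma point_disjoint u w : tarski_rule S -> is_point u -> is_point w ->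
  u != w -> u `&` w = \bot.
Proof.
move=> tarski u_pt w_pt; apply: contraNeq => uw0; apply/eqP.
apply: le_point => //.
have [u_inj _ u_vec] := pointP u_pt; have [_ _ w_vec] := pointP w_pt.
set m := u `&` w in uw0 *; have m_vec : is_vector m by exact: vectorI.
have mtop : m^T * \top = \top.
  have := congr1 conv (tarski m uw0).
  by rewrite -mulgA (mul_top m_vec) convM conv_top.
have e1 : m * u^T <= 1 by apply: le_trans u_inj; rewrite le_mulr ?leIl.
(* As the converse of [m * u^T <= 1], the element [u * m^T] equals it, so
   [u = m * u^T * \top <= m]. *)
rewrite -(mul_top u_vec) -mtop mulgA -[u * _]convK convM convK le1_conv //.
rewrite -mulgA; apply: le_trans (vector_mul_le _ m_vec) _.
exact: leIr.
Qed.

(* Row [u] of [p] consists of the single entry at the parent of [u]. *)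
Lemma point_meet p u : is_point u -> u `&` p = u `&` (p^T * u)^T.
Proof.
move=> /pointP[u_inj u_surj u_vec].
rewrite vector_conv_rect ?vectorM // convM convK; apply/eqP; rewrite eq_le.
apply/andP; split.
  rewrite -{1}(mul_top u_vec); apply: le_trans (dedekind _ _ _) _.
  by rewrite meet1x.
rewrite lexI vector_mul_le //= mulgA -[leRHS]mul1g; exact: le_mulr.
Qed.

(** * Redirecting a set of nodes to a common parent *)

(* After each iteration of the loop the program variable [p] has the value
   [redirect y p0 v], where the vector [v] is the set of nodes traversed. *)
Definition redirect (y p v : S) : S := (v `&` y^T) `|` (~` v `&` p).

Lemma redirect_bot y p : redirect y p \bot = p.
Proof. by rewrite /redirect meet0x join0x compl0 meet1x. Qed.

Lemma redirect_redirect y p v u :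
  (u `&` y^T) `|` (~` u `&` redirect y p v) = redirect y p (v `|` u).
Proof.
rewrite /redirect complU meetUr !meetA joinA; congr (_ `|` (_ `&` _)).
  rewrite -meetUl; congr (_ `&` _).
  by rewrite joinIr joinxC meet1x joinC.
exact: meetC.
Qed.

Lemma redirect_joinr y p v u :
  u `&` y^T = u `&` p -> redirect y p (v `|` u) = redirect y p v.
Proof.
move=> uE; rewrite -redirect_redirect uE.
have -> : u `&` p = u `&` redirect y p v.
  rewrite /redirect meetUr !(meetCA u) uE -meetUl.
  by rewrite joinxC meet1x.
by rewrite -meetUl joinxC meet1x.
Qed.

Lemma top_point u : is_point u -> \top * u = \top.
Proof.
by move=> u_pt; rewrite -conv_top -[u]convK -convM point_top // conv_top.
Qed.

(** For a vector [y] and a point [u], the product [y * u] is [y] itself, so nodes in [v] acquire the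
    parent [y]. *)
Lemma redirect_conv_in y p v u : is_vector v -> u <= v ->
  (redirect y p v)^T * u = y * u.
Proof.
move=> v_vec /meet_idPr uv; rewrite convU mulUl !vector_conv_meetM ?vectorC //.
by rewrite convK uv -uv meetA meetCx meet0x mulx0 joinx0.
Qed.

(** This is how the loop still reads original parents at nodes not yet redirected. *)
Lemma redirect_conv_out y p v u : is_vector v -> u `&` v = \bot ->
  (redirect y p v)^T * u = p^T * u.
Proof.
move=> v_vec uv; rewrite convU mulUl !vector_conv_meetM ?vectorC //.
rewrite meetC uv mulx0 join0x; congr (_ * _); apply/meet_idPr.
by rewrite -disj_leC uv.
Qed.

(** The rows in [v] and those outside do not interact: univalence reduces to [y * y^T <= 1] on the
    former and to that of [p] on the latter. *)
Lemma redirect_mapping y p v : is_point y -> is_vector v -> is_mapping p ->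
  is_mapping (redirect y p v).
Proof.
move=> y_pt v_vec /andP[p_univ p_total]; have [y_inj _ y_vec] := pointP y_pt.
apply/andP; split.
  rewrite /is_univalent /redirect mulUr leUx -/(redirect y p v).
  rewrite vector_conv_rect // mulgA redirect_conv_in //.
  rewrite (le_trans (le_mulr _ (vector_mul_le _ y_vec))) //=.
  rewrite convU mulUl !vector_conv_meetM ?vectorC // meetA meetxC meet0x mulx0.
  rewrite join0x meetA meetxx; apply: le_trans p_univ.
  by rewrite le_mull ?leIr.
rewrite total_top mulUl !vector_meetM ?vectorC //.
move: p_total; rewrite total_top => /eqP ->; rewrite point_top // !meetx1.
by rewrite joinxC.
Qed.

(** By confluence [E] is an equivalence, so it contains both stars once it contains [p]. Comparing
    components thus reduces to comparing single edges. *)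
Lemma equiv_mono p q : is_univalent q -> p <= q^* * q^T^* ->
  p^* * p^T^* <= q^* * q^T^*.
Proof.
move=> q_univ pq; set E := q^* * q^T^*.
have E1 : 1 <= E by rewrite -[leLHS]mulg1 le_mul2 ?star_ge1.
have EE : E * E <= E.
  rewrite /E -mulgA (mulgA q^T^*).
  apply: le_trans (le_mull _ (le_mulr _ (univalent_church_rosser q_univ))) _.
  by rewrite !mulgA -(mulgA (q^* * q^*)) le_mul2 ?star_idem.
have E_sym : E^T = E by rewrite convM !conv_star convK.
have star_le a : a <= E -> a^* <= E.
  by move=> aE; apply: star_least E1 _; apply: le_trans EE; apply: le_mulr.
by apply: le_trans EE; rewrite le_mul2 ?star_le // -E_sym le_conv.
Qed.

(** * Postconditions for the compressed forest *)

Section CompressedForest.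
Variables x y p0 : S.
Hypotheses (p0_forest : is_forest p0) (x_point : is_point x).
Hypotheses (y_point : is_point y).
Hypothesis y_root : y = (p0^T^* * x) `&` ((p0 `&` 1) * \top).

Let v := p0^T^* * x.
Let p := redirect y p0 v.

Let p0_univ : is_univalent p0. Proof. by case/andP: p0_forest => /andP[]. Qed.
Let x_vec : is_vector x. Proof. by case: (pointP x_point). Qed.
Let y_vec : is_vector y. Proof. by case: (pointP y_point). Qed.
Let y_inj : y * y^T <= 1. Proof. by case: (pointP y_point). Qed.
Let v_vec : is_vector v. Proof. exact: vectorM. Qed.
Let yv : y <= v. Proof. by rewrite y_root leIl. Qed.
Let xv : x <= v. Proof. by rewrite -[leLHS]mul1g le_mulr ?star_ge1. Qed.
Let v_closed : p0^T * v <= v.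
Proof. by rewrite mulgA le_mulr // mul_star_le. Qed.
Let y_self : (p0 `&` 1) * y = y.
Proof.
rewrite -vector_meet_coreflexive ?leIr //; apply/meet_idPr.
by rewrite y_root leIr.
Qed.

(** The loop part of [p0] is its own converse and fixes [y], whence [y <= p0^T * y]; both sides are
    points. *)
Lemma root_parent : p0^T * y = y.
Proof.
apply/esym/le_point => //; first by apply: mapping_point; case/andP: p0_forest.
by rewrite -{1}y_self -(le1_conv (leIr 1 p0)) le_mulr // le_conv leIl.
Qed.

(* Confluence of the univalent [p0] puts [v * y^T] below [p0^* `|` p0^T^*]; as
   [y] is a root, its meet with [p0^T^*] lies on the diagonal. *)
Let v_y_le_star : v `&` y^T <= p0^*.
Proof.
have h : v `&` y^T <= p0^* `|` p0^T^*.
  rewrite vector_conv_rect // y_root convI convM conv_star convK.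
  apply: le_trans (univalent_star p0_univ).
  apply: (@le_trans _ _ (v * (x^T * p0^*))); first by rewrite le_mull ?leIl.
  rewrite /v -mulgA (mulgA x) le_mull // -[leRHS]mul1g le_mulr //.
  by case: (pointP x_point).
have fix_y : p0^T^* * y <= y by apply: star_inductl; rewrite root_parent joinxx.
rewrite -(meet_idPl h) meetUr leUx leIr /=.
have h1 : y `&` p0^* <= 1.
  rewrite point_meet // conv_star vector_conv_rect ?vectorM //.
  by apply: le_trans y_inj; rewrite le_mull ?le_conv.
apply: le_trans (star_ge1 _); rewrite -conv_star -meetA -convI -conv1.
by apply: le_trans (leIr _ _) _; rewrite le_conv.
Qed.

(** Every non-loop edge of [p] is a nonempty path of non-loop edges of [p0], new edges by
    [v_y_le_star]; so a cycle in [p] would give one in [p0]. *)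
Lemma redirect_forest : is_forest p.
Proof.
have [p0_map p0_acyc] := andP p0_forest.
rewrite /is_forest redirect_mapping //=; apply: le_trans p0_acyc.
apply: plus_mono; rewrite meetUl leUx; apply/andP; split; last first.
  by apply: le_trans (le_plus _); rewrite leI2 ?leIr.
apply: le_trans (star_le_plus _); rewrite star_irreflexive_part leI2 //.
Qed.

(** A new loop can only sit at [y], already a root. Conversely, a loop of [p0] inside [v] lies at
    [y] by [y_root] and survives. *)
Lemma redirect_self : p `&` 1 = p0 `&` 1.
Proof.
apply/eqP; rewrite eq_le !lexI !leIr !andbT; apply/andP; split.
  rewrite meetUl leUx; apply/andP; split; last first.
    exact: le_trans (leIl _ _) (leIr _ _).
  set a := _ `&` 1; have ay : a <= y^T by apply: le_trans (leIl _ _) (leIr _ _).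
  have ay' : a <= y by rewrite -[a]le1_conv ?leIr // le_convl.
  apply: (@le_trans _ _ (y * y^T)).
    by rewrite -vector_conv_rect // lexI ay'.
  rewrite -{1}y_self -mulgA; apply: le_trans (leIl p0 1).
  by rewrite -[leRHS]mulg1 le_mull.
apply: (le_meetU (u := v)); last first.
  by apply: le_trans (leUr _ _); rewrite meetC leI2 ?leIl.
apply: le_trans (leUl _ _); rewrite lexI leIr /=.
have e1 : p0 `&` 1 `&` v <= 1 by apply: le_trans (leIl _ _) (leIr _ _).
rewrite -(le1_conv e1) le_conv y_root meetC lexI leIl /=.
by apply: le_trans (leIr _ _) _; rewrite -[leLHS]mulg1 le_mull ?lex1.
Qed.

(** The new parent of [x] is [y], so [y] is reached in one step; and [v] remains closed under [p^T],
    since [p^T * v = y * v <= y]. *)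
Lemma redirect_reach : y = (p^T^* * x) `&` ((p `&` 1) * \top).
Proof.
rewrite redirect_self; apply/eqP; rewrite eq_le lexI -andbA; apply/and3P; split.
- have -> : y = p^T * x.
    by rewrite redirect_conv_in // -(mul_top y_vec) -mulgA top_point.
  by rewrite le_mulr ?le_star.
- by rewrite [leLHS]y_root leIr.
rewrite [leRHS]y_root leI2 //; apply: star_inductl; rewrite leUx xv /=.
by rewrite redirect_conv_in // (le_trans (vector_mul_le _ y_vec)).
Qed.

(* The entries of [p0] removed by the redirection lie in [v * v^T], hence in
   [(v * y^T) * (v * y^T)^T]: both ends now have parent [y]. *)
Lemma redirect_equiv : p^* * p^T^* = p0^* * p0^T^*.
Proof.
have univ_p : is_univalent p.
  by case/andP: redirect_forest => /andP[].
have star_le b : b^* <= b^* * b^T^* by rewrite -[leLHS]mulg1 le_mull ?star_ge1.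
apply/eqP; rewrite eq_le !equiv_mono //.
  rewrite -(meet1x p0) -(joinxC v) meetUl leUx; apply/andP; split; last first.
    by apply: le_trans (star_le _); apply: le_trans (le_star _); exact: leUr.
  have sub : v `&` p0 <= v^T.
    rewrite -le_convl; apply: le_trans v_closed.
    by rewrite -[leLHS]mulg1 vector_conv_meetM // le_mull ?leIl.
  have vy : v * y^T <= p by rewrite -vector_conv_rect // leUl.
  apply: (@le_trans _ _ (v * v^T)).
    by rewrite -vector_conv_rect // lexI leIl.
  apply: (@le_trans _ _ (p * p^T)); last by rewrite le_mul2 ?le_star.
  apply: (@le_trans _ _ ((v * y^T) * (v * y^T)^T)); last first.
    by rewrite le_mul2 ?le_conv.
  rewrite (convM v) convK mulgA -(mulgA v) -[X in X * _ <= _]mulg1.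
  rewrite le_mulr ?le_mull //.
  by case: (pointP y_point).
rewrite leUx; apply/andP; split; last first.
  by apply: le_trans (star_le _); apply: le_trans (le_star _); exact: leIr.
(* A new edge lies in [v * v^T], which is below [p0^T^* * p0^*] by injectivity of [x]. *)
apply: (@le_trans _ _ (p0^T^* * p0^*)); last exact: univalent_church_rosser.
rewrite vector_conv_rect //; apply: le_trans (le_mull _ (_ : y^T <= v^T)) _.
  by rewrite le_conv.
rewrite convM conv_star convK -mulgA (mulgA x) le_mull //.
rewrite -[leRHS]mul1g le_mulr //; by case: (pointP x_point).
Qed.

End CompressedForest.
End KleeneRelationAlgebra.

(** Extends what is shown of one constructed execution to every final state. *)
Lemma exec_deterministic (var : eqType) (val : Type) (c : cmd var val) s s1 s2 :
  exec c s s1 -> exec c s s2 -> s1 = s2.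
Proof.
move=> e1; elim: e1 s2 => {c s s1}.
- by move=> s s2 e2; inversion e2.
- by move=> v e s s2 e2; inversion e2.
- move=> c1 c2 t1 t2 t3 _ IH1 _ IH2 s2 e2; inversion e2; subst.
  by apply: IH2; erewrite IH1; eassumption.
- move=> b c1 c2 t1 t2 bt _ IH s2 e2; inversion e2; subst; first exact: IH.
  by exfalso; move: bt; apply/negP.
- move=> b c1 c2 t1 t2 bt _ IH s2 e2; inversion e2; subst; last exact: IH.
  by exfalso; move/negP: bt; apply.
- move=> b c t1 t2 t3 bt _ IH1 _ IH2 s2 e2; inversion e2; subst.
    by apply: IH2; erewrite IH1; eassumption.
  by exfalso; move: bt; apply/negP.
- move=> b c t bt s2 e2; inversion e2; subst=> //.
  by exfalso; move/negP: bt; apply.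
Qed.

(** * Traversal of the path and termination *)

Section Traversal.
Context {d : Order.disp_t} {S : finKleeneRelAlgType d}.
Hypothesis tarski : tarski_rule S.
Variables x y p0 : S.
Hypotheses (p0_forest : is_forest p0) (x_point : is_point x).
Hypotheses (y_point : is_point y).
Hypothesis y_root : y = (p0^T^* * x) `&` ((p0 `&` 1) * \top).

Let parent (u : S) := p0^T * u.
Let node k := iter k parent x.
Let visited k := \join_(i < k) node i.
Let v := p0^T^* * x.

Let p0_map : is_mapping p0. Proof. by case/andP: p0_forest. Qed.

Let node_point k : is_point (node k).
Proof. by elim: k => //= k; apply: mapping_point. Qed.

Let y_parent : parent y = y. Proof. exact: root_parent y_root. Qed.

(** The join of all iterated parents contains [v] by star induction, hence [y]. Were [y] none of
    them, it would be disjoint from that join and so empty. *)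
Lemma root_reachable : exists n, node n = y.
Proof.
suff xy : fconnect parent x y by exists (findex parent x y); exact: iter_findex.
apply/negPn/negP => not_xy.
have vJ : v <= \join_(u | fconnect parent x u) u.
  apply: star_inductl; rewrite leUx; apply/andP; split; first exact: joins_sup.
  rewrite (big_morph _ (mulUr p0^T) (mulx0 p0^T)); apply: joins_le => u xu.
  by apply: (joins_sup (j := parent u)); apply: connect_trans xu (fconnect1 _ _).
have Jy : \join_(u | fconnect parent x u) u <= ~` y.
  apply: joins_le => u xu; rewrite -disj_leC point_disjoint //.
    by rewrite -(iter_findex xu); exact: node_point.
  by apply: contraNneq not_xy => <-.
(* Only in the one-element algebra can [y] be empty; there [x = y]. *)
have y0 : y = \bot.
  apply/eqP; rewrite -[y]meetxx disj_leC; apply: le_trans Jy.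
  by apply: le_trans vJ; rewrite y_root leIl.
have [_ y_surj _] := pointP y_point.
have x0 : x = \bot.
  apply/eqP; rewrite -lex0 -[x]mul1g -(mul0x x) le_mulr //.
  by rewrite -(mulx0 y^T) -y0.
by case/negP: not_xy; rewrite x0 y0 connect0.
Qed.

(* A repetition before [y] would yield an earlier visit of [y], so distinctness
   of the nodes needs minimality of [m] only, not acyclicity of [p0]. *)
Lemma node_disjoint m j : (forall k, node k.+1 == y -> (m <= k)%N) ->
  node m.+1 = y -> (j <= m)%N -> node j `&` visited j = \bot.
Proof.
move=> m_min m_y jm; apply/eqP; rewrite meetC disj_leC; apply: joins_le => i _.
rewrite -disj_leC point_disjoint //; apply/eqP => ij.
have ltij := ltn_ord i.
(* Advancing both nodes by [m.+1 - j] parents takes [node j] to [y], hence also [node i], at an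
   index below [m.+1]. *)
have : node (i + (m.+1 - j)) == y.
  rewrite /node addnC iterD -/(node i) ij -iterD subnK ?(leqW jm) //.
  exact/eqP.
rewrite subSn // addnS => /m_min; rewrite leqNgt => /negP; apply.
by rewrite -{2}(subnKC jm) ltn_add2r.
Qed.

(* [node m] and [y] have parent [y] in [p0] already, so redirecting them too
   changes nothing; together with [visited m] they exhaust [v]. *)
Lemma redirect_visited m : node m.+1 = y ->
  redirect y p0 (visited m) = redirect y p0 v.
Proof.
move=> m_y.
have row u : is_point u -> parent u = y -> u `&` y^T = u `&` p0.
  by move=> u_pt u_y; rewrite (point_meet p0 u_pt) -/(parent u) u_y.
rewrite -(redirect_joinr _ (row _ (node_point m) m_y)).
rewrite -(redirect_joinr _ (row _ y_point y_parent)); congr redirect.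
have node_v k : node k <= v.
  elim: k => [|k IH]; first by rewrite -[leLHS]mul1g le_mulr ?star_ge1.
  apply: le_trans (le_mull _ IH) _.
  by rewrite mulgA le_mulr ?mul_star_le.
have -> : visited m `|` node m = visited m.+1 by rewrite /visited big_ord_recr.
apply/eqP; rewrite eq_le leUx -{1}m_y node_v andbT; apply/andP; split.
  by apply: joins_le => i _.
have node_vis (k : nat) : (k <= m.+1)%N -> node k <= visited m.+1 `|` y.
  rewrite leq_eqVlt => /predU1P[->|km]; first by rewrite m_y leUr.
  apply: le_trans (leUl _ _).
  exact: (@joins_sup _ _ _ (Ordinal km) xpredT (fun i : 'I_m.+1 => node i)).
apply: star_inductl; rewrite leUx (node_vis 0%N) //= mulUr leUx -/(parent y).
rewrite y_parent leUr andbT /visited.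
rewrite (big_morph _ (mulUr p0^T) (mulx0 p0^T)); apply: joins_le => i _.
exact: (node_vis i.+1).
Qed.

Lemma path_compression_exec (s0 : state pvar S) : s0 var_p = p0 ->
  exists2 s, exec (path_compression x y) s0 s & s var_p = redirect y p0 v.
Proof.
move=> s0_p.
(* The loop test looks one parent ahead, hence the successor; if [x] is already [y], then [0] works
   because [y] is its own parent. *)
have ex_m : exists m, node m.+1 == y.
  have [[|n] n_y] := root_reachable; last by exists n; apply/eqP.
  by exists 0%N; rewrite -[node 1]/(parent (node 0)) n_y y_parent.
case: (ex_minnP ex_m) => m /eqP m_y m_min.
have visited_vec k : is_vector (visited k).
  rewrite /visited; elim/big_ind: _ => [|a b|i _]; first exact: vector_bot.
    exact: vectorU.
  by case: (pointP (node_point i)).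
pose inv j (s : state pvar S) :=
  s var_p = redirect y p0 (visited j) /\ s var_w = node j.
(* Here [k] counts the iterations still to come. *)
suff loop k : forall j s, (j + k)%N = m -> inv j s -> exists2 s',
    exec (While (fun s => y != (s var_p)^T * s var_w)
      (Seq (Assign var_t (fun s => s var_w))
      (Seq (Assign var_w (fun s => (s var_p)^T * s var_w))
           (Assign var_p (fun s =>
              (s var_t `&` y^T) `|` (~` (s var_t) `&` s var_p)))))) s s' &
    s' var_p = redirect y p0 v.
  have [|s' e s'_p] := loop m 0%N (update s0 var_w x) (add0n m).
    by rewrite /inv /visited big_ord0 redirect_bot.
  by exists s' => //; apply: exec_seq e; exact: exec_assign.
elim: k => [|k IH] j s jk [s_p s_w].
all: have jm : (j <= m)%N by rewrite -jk leq_addr.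
all: have step : (s var_p)^T * s var_w = node j.+1
  by rewrite s_p s_w redirect_conv_out // (node_disjoint m_min m_y).
  (* The loop stops at [node m] without redirecting it; [redirect_visited] closes the gap between
     [visited m] and [v]. *)
  rewrite addn0 in jk; exists s; last by rewrite s_p jk redirect_visited.
  by apply: exec_while_false; rewrite step jk m_y eqxx.
set s1 := update s var_t (s var_w).
set s2 := update s1 var_w ((s1 var_p)^T * s1 var_w).
set s3 := update s2 var_p ((s2 var_t `&` y^T) `|` (~` (s2 var_t) `&` s2 var_p)).
have [||s' e s'_p] := IH j.+1 s3; first by rewrite addSnnS.
  rewrite /inv /s3 /s2 /s1 /update /= step; split=> //.
  by rewrite s_p s_w redirect_redirect /visited big_ord_recr.
exists s' => //; apply: exec_while_true e.
  rewrite step eq_sym; apply/negP => /m_min.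
  by rewrite -jk leqNgt addnS ltnS leq_addr.
by do 2![apply: exec_seq; first exact: exec_assign]; exact: exec_assign.
Qed.

End Traversal.

Theorem mainTheorem17 (d : Order.disp_t) (S : finKleeneRelAlgType d)
    (tarski : tarski_rule S) (p0 x y : S)
    (p0_forest : is_forest p0) (x_point : is_point x) (y_point : is_point y)
    (y_root : y = (p0^T^* * x) `&` ((p0 `&` 1) * \top))
    (s0 : state pvar S) (s0_p : s0 var_p = p0) :
  terminates (path_compression x y) s0 /\
  forall s : state pvar S, exec (path_compression x y) s0 s ->
    let p := s var_p in
    let v := p0^T^* * x in
    [/\ is_forest p,
        y = (p^T^* * x) `&` ((p `&` 1) * \top),
        p^* * p^T^* = p0^* * p0^T^*,
        p `&` 1 = p0 `&` 1
      & p = (v `&` y^T) `|` (~` v `&` p0)].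
Proof.
have [s1 e1 s1_p] :=
  path_compression_exec tarski p0_forest x_point y_point y_root s0_p.
split=> [|s e]; first by exists s1.
rewrite -(exec_deterministic e1 e) s1_p /=; split=> //.
- exact: redirect_forest.
- exact: redirect_reach.
- exact: redirect_equiv.
exact: redirect_self.
Qed.
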